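(* Let $G_n=K_{n_1}(u_0=v_0)S_{n_2}$ and $G_{n'}=K_{n_1'}(u_0'=v_0')S_{n_2'}$ be two generalized starlike trees. Then $G_n$ and $G_{n'}$ are isomorphic if and only if they have the same path sequence.
   Context: Graphs are finite and simple. A path of length $h$ in $G$ is a subgraph that is a path with $h$ edges ($h+1$ distinct vertices); paths are undirected, and paths of length $0$ are single vertices. $P_h(G)$ is the number of paths of length $h$ in $G$. The path sequence of $G$ is $P(G)=(P_0(G),P_1(G),\ldots,P_\rho(G))$, where $\rho=\rho(G)$ is the length of a longest path in $G$. A starlike tree is a tree with exactly one vertex $v_0$ of degree greater than $2$, called its root. The generalized starlike tree $K_{n_1}(u_0=v_0)S_{n_2}$, with $n=n_1+n_2-1$ vertices, is obtained from the disjoint union of the complete graph $K_{n_1}$ on $n_1$ vertices and a starlike tree $S_{n_2}$ on $n_2$ vertices by identifying a vertex $u_0$ of $K_{n_1}$ with the root $v_0$ of $S_{n_2}$. *)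

(* Defs.v *)
From mathcomp Require Import all_boot.

Set Implicit Arguments.
Unset Strict Implicit.
Unset Printing Implicit Defensive.

Record sgraph := SGraph {
  vertex :> finType;
  adj : rel vertex;
  adj_sym : symmetric adj;
  adj_irrefl : irreflexive adj
}.

Definition isomorphic (G H : sgraph) : Prop :=
  exists2 f : G -> H, bijective f & forall x y, adj (f x) (f y) = adj x y.

Definition degree (G : sgraph) (x : G) : nat := #|[set y | adj x y]|.

Definition connected_graph (G : sgraph) : Prop :=
  0 < #|G| /\ forall x y : G, connect (@adj G) x y.

(* A closed walk of length 2, which traverses one edge back and forth,
   satisfies ucycle, hence the lower bound on the size. *)
Definition acyclic (G : sgraph) : Prop :=
  forall c : seq G, 2 < size c -> ~ ucycle (@adj G) c.

Definition tree (G : sgraph) : Prop := connected_graph G /\ acyclic G.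

Definition starlike_tree (S : sgraph) (v0 : S) : Prop :=
  [/\ tree S, 2 < degree v0 & forall v : S, 2 < degree v -> v = v0].
Arguments starlike_tree : clear implicits.

Definition edges_along (G : sgraph) (s : seq G) : {set {set G}} :=
  [set [set p.1; p.2] | p in zip s (behead s)].

(* A subgraph is a pair (vertex set, edge set); a path and its reversal give
   the same subgraph, and are therefore counted once. *)
Definition path_subgraphs (G : sgraph) (h : nat) :
    {set {set G} * {set {set G}}} :=
  [set ([set x in t], edges_along t)
     | t : h.+1.-tuple G & uniq t && sorted (@adj G) t].

Definition path_number (G : sgraph) (h : nat) : nat := #|path_subgraphs G h|.

(* A path has distinct vertices, so its length is less than #|G|. *)
Definition longest_path (G : sgraph) : nat :=
  \max_(h < #|G| | 0 < path_number G h) h.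

Definition path_sequence (G : sgraph) : seq nat :=
  mkseq (path_number G) (longest_path G).+1.

Section Complete.
Variable n : nat.
Definition complete_adj : rel 'I_n := fun i j => i != j.
Fact complete_sym : symmetric complete_adj.
Proof. by move=> i j; rewrite /complete_adj eq_sym. Qed.
Fact complete_irrefl : irreflexive complete_adj.
Proof. by move=> i; rewrite /complete_adj eqxx. Qed.
Definition complete_graph := SGraph complete_sym complete_irrefl.
End Complete.

(* The disjoint union of G and H with u identified with v: the common vertex is
   represented by inr v, and the edges of G at u are transferred to it. *)
Section Identify.
Variables (G H : sgraph) (u : G) (v : H).

Definition identify_adj : rel ({x : G | x != u} + H)%type := fun a b =>
  match a, b with
  | inl x, inl y => adj (val x) (val y)
  | inr x, inr y => adj x y
  | inl x, inr y => adj (val x) u && (y == v)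
  | inr x, inl y => (x == v) && adj u (val y)
  end.

Fact identify_sym : symmetric identify_adj.
Proof. by case=> x [] y /=; rewrite adj_sym // andbC. Qed.

Fact identify_irrefl : irreflexive identify_adj.
Proof. by case=> x /=; rewrite adj_irrefl. Qed.

Definition identify := SGraph identify_sym identify_irrefl.

Lemma card_identify : #|identify| = #|G| + #|H| - 1.
Proof.
rewrite card_sum card_sig (eq_card (B := predC1 u)) //.
have: 0 < #|G| by apply/card_gt0P; exists u.
by rewrite cardC1; case: #|G| => // k _; rewrite addSn subn1.
Qed.
End Identify.

(* K_n1(u0 = v0)S; it is a generalized starlike tree when
   starlike_tree S v0 holds. *)
Definition gen_starlike (n1 : nat) (u0 : complete_graph n1)
    (S : sgraph) (v0 : S) : sgraph :=
  identify u0 v0.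
Arguments gen_starlike : clear implicits.

(* Main.v *)
Require Import Defs.
From mathcomp Require Import all_boot.
From mathcomp Require Import zify.

Set Implicit Arguments.
Unset Strict Implicit.
Unset Printing Implicit Defensive.

(* For [h > 0], [2 P_h] is the number of directed paths of length [h].  A
   generalized starlike tree consists of a root, the [k] other vertices of the
   clique and legs of lengths [l_i]; since a clique of order 2 is just one more
   leg of length 1, one may assume [k <> 1].  Let [b_s] be the number of legs of
   length at least [s].  [P_0] and [P_1] determine [k (k - 1)], hence [k], and
   the sum of the [l_i].  Counting directed paths by their starting point
   expresses [2 P_(h+1)] through [b_1, ..., b_h], [k] and the sum of the [l_i].
   In this expression [b_1] occurs as [b_1^2 + (2k - 3) b_1] for [h = 1], and
   [b_h] occurs with the coefficient [2 b_1 + 2k - 4] for [h > 1]; since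
   [b_1 > 2], the [b_h] are determined one after the other. *)

(** * Directed paths *)

Section EdgesAlong.
Variable G : sgraph.
Implicit Types (x y : G) (s t : seq G).

Lemma edges_along1 x : edges_along [:: x] = set0.
Proof. by apply/setP=> e; rewrite !inE; apply/imsetP; case. Qed.

Lemma edges_along_cons x y s :
  edges_along [:: x, y & s] = [set x; y] |: edges_along (y :: s).
Proof.
apply/setP=> e; rewrite !inE; apply/imsetP/orP => /=.
  case=> p; rewrite inE => /orP[/eqP-> ->|ps ->]; [by left|right].
  by apply/imsetP; exists p.
case=> [/eqP->|/imsetP[p ps ->]].
  by exists (x, y); rewrite ?mem_head.
by exists p; rewrite // inE ps orbT.
Qed.

Lemma edges_along_cat s x t :
  edges_along (s ++ x :: t) = edges_along (rcons s x) :|: edges_along (x :: t).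
Proof.
elim: s => [|y [|z s] IHs] /=; first by rewrite edges_along1 set0U.
  by rewrite !edges_along_cons edges_along1 setU0.
by rewrite !edges_along_cons -setUA -IHs.
Qed.

Lemma edges_along_rev s : edges_along (rev s) = edges_along s.
Proof.
elim: s => [//|x [//|y s] IHs].
rewrite rev_cons rev_cons -!cats1 -catA edges_along_cat -rev_cons IHs.
by rewrite !edges_along_cons edges_along1 setU0 setUC [[set y; x]]setUC.
Qed.

Lemma edges_along_mem s e x : e \in edges_along s -> x \in e -> x \in s.
Proof.
elim: s => [|y [|z s] IHs]; first by case/imsetP.
  by rewrite edges_along1 inE.
rewrite edges_along_cons !inE => /orP[/eqP->|/IHs{}IHs /IHs].
  by rewrite !inE => /orP[]->; rewrite ?orbT.
by rewrite inE => ->; rewrite orbT.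
Qed.

Lemma edges_along_headE x y s e :
  uniq [:: x, y & s] -> e \in edges_along [:: x, y & s] -> x \in e ->
  e = [set x; y].
Proof.
case/andP=> xs _; rewrite edges_along_cons => /setU1P[//|es xe].
by rewrite (edges_along_mem es xe) in xs.
Qed.

(** The only edge at the head [x] reveals the second vertex, and removing this edge leaves the edge
    set of the tail, so induction applies. *)
Lemma edges_along_head_inj x s t :
    uniq (x :: s) -> uniq (x :: t) ->
  edges_along (x :: s) = edges_along (x :: t) -> s = t.
Proof.
elim: s x t => [|y s IHs] x [|z t] // Us Ut.
- by rewrite edges_along1 edges_along_cons => /setP/(_ [set x; z]); rewrite !inE eqxx.
- by rewrite edges_along1 edges_along_cons => /setP/(_ [set x; y]); rewrite !inE eqxx.
move=> Est.
have [xs Us'] := andP Us; have [xt Ut'] := andP Ut.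
have /setP/(_ y): [set x; y] = [set x; z].
  apply: edges_along_headE Ut _ _; last by rewrite !inE eqxx.
  by rewrite -Est edges_along_cons !inE eqxx.
have /negPf yx: y != x by move: xs; rewrite inE eq_sym; case: eqP.
rewrite !inE yx eqxx /= => /esym/eqP yz; subst z.
congr (_ :: _); apply: IHs Us' Ut' _.
have E u : x \notin y :: u ->
    edges_along (y :: u) = edges_along [:: x, y & u] :\ [set x; y].
  move=> xu; rewrite edges_along_cons setU1K //.
  by apply: contra xu => /edges_along_mem; apply; rewrite !inE eqxx.
by rewrite (E s) // (E t) // Est.
Qed.

(** The head of [t] lies on only one edge, so it is an end of [s], and [edges_along_head_inj]
    applies to [s] or to its reversal. Single vertices must be excluded, since they have no
    edges. *)
Lemma edges_along_inj s t :
    1 < size s -> 1 < size t -> uniq s -> uniq t ->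
  edges_along s = edges_along t -> t = s \/ t = rev s.
Proof.
case: t => [|x [|y t]] // s1 _ Us Ut Est.
have xs: x \in s.
  apply: (@edges_along_mem _ [set x; y]); last by rewrite !inE eqxx.
  by rewrite Est edges_along_cons !inE eqxx.
case/splitPr: xs s1 Us Est => s1 s2; case: (lastP s1) => [|{}s1 a].
  by move=> _ Us Est; left; rewrite [t in _ :: t](edges_along_head_inj Ut Us).
case: s2 => [|b s2] _ Us Est.
  right; rewrite rev_cat /=.
  congr (_ :: _); apply: edges_along_head_inj Ut _ _.
    by rewrite -rev_rcons rev_uniq -cats1.
  by rewrite -Est -rev_rcons edges_along_rev cats1.
(* Here [x] would be interior to [s], with neighbours [a] and [b]: both edges would equal the unique
   edge of [t] at [x], against [a != b]. *)
have Ea: [set a; x] \in edges_along [:: x, y & t].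
  rewrite -Est cat_rcons edges_along_cat inE orbC edges_along_cons.
  by rewrite !inE eqxx.
have Eb: [set x; b] \in edges_along [:: x, y & t].
  by rewrite -Est edges_along_cat inE orbC edges_along_cons !inE eqxx.
have /setP/(_ a) := edges_along_headE Ut Ea (set22 _ _).
have <-:= edges_along_headE Ut Eb (set21 _ _).
rewrite !inE eqxx /= => /esym.
move: Us; rewrite cat_rcons cat_uniq /= !inE !negb_or.
by case/and5P=> _ _ /andP[/negPf-> /andP[/negPf->]].
Qed.

End EdgesAlong.

Definition path_tuples (G : sgraph) (h : nat) : {set h.+1.-tuple G} :=
  [set t : h.+1.-tuple G | uniq t && sorted (@adj G) t].

Definition subgraph_of_path (G : sgraph) (s : seq G) :
  {set G} * {set {set G}} := ([set x in s], edges_along s).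

Lemma path_subgraphsE (G : sgraph) h :
  path_subgraphs G h = [set subgraph_of_path (val t) | t in path_tuples G h].
Proof.
apply/setP=> p; apply/imsetP/imsetP; case=> t Pt ->; exists t => //;
  by move: Pt; rewrite !inE.
Qed.

(** A path of length 0 is its own reversal, so no factor 2 arises. *)
Lemma path_number0 (G : sgraph) : path_number G 0 = #|path_tuples G 0|.
Proof.
rewrite /path_number path_subgraphsE card_in_imset // => t u _ _.
case/tupleP: t => x t; case/tupleP: u => y u; rewrite (tuple0 t) (tuple0 u).
by case=> /setP/(_ x); rewrite !inE eqxx => /esym/eqP xy; apply: val_inj; rewrite /= xy.
Qed.

(** The fibres of [subgraph_of_path] are the pairs consisting of a tuple and its reversal, which
    differ since there are at least two vertices. *)
Lemma path_number_double (G : sgraph) h :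
  #|path_tuples G h.+1| = (path_number G h.+1).*2.
Proof.
rewrite /path_number path_subgraphsE -sum1_card.
rewrite (partition_big_imset (fun t => subgraph_of_path (val t))) /=.
rewrite -muln2 -sum_nat_const; apply: eq_bigr => _ /imsetP[t Pt ->].
have := Pt; rewrite inE => /andP[Ut St].
have rev_t: [tuple of rev t] != t.
  apply/eqP=> /(congr1 val) /=; move: Ut; case/tupleP: t {Pt St} => x t.
  case/tupleP: t => y t /= Uxyt.
  have: last x (rev [:: x, y & t]) = x by rewrite rev_cons last_rcons.
  move=> Ex Er; rewrite Er /= in Ex; move: Uxyt => /andP[].
  by rewrite -Ex mem_last.
rewrite (eq_bigl (mem [set t; [tuple of rev t]])); last first.
  move=> u; rewrite [in RHS]/= [u \in path_tuples _ _]inE.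
  apply/andP/idP => [[/andP[Uu Su] /eqP[_ Eut]]|].
    have [||E|E] := @edges_along_inj G t u _ _ Ut Uu (esym Eut).
    - by rewrite size_tuple.
    - by rewrite size_tuple.
    - suff ->: u = t by apply: set21.
      exact: val_inj.
    - suff ->: u = [tuple of rev t] by apply: set22.
      exact: val_inj.
  case/set2P=> ->; first by rewrite Ut St.
  rewrite /= rev_uniq Ut rev_sorted (eq_sorted (e' := @adj G)) ?St; last first.
    by move=> x y; rewrite adj_sym.
  split=> //; apply/eqP; congr (_, _); last exact: edges_along_rev.
  by apply/setP=> x; rewrite !inE mem_rev.
by rewrite sum1_card cards2 eq_sym rev_t.
Qed.

Lemma eq_path_number (G H : sgraph) h :
  (path_number G h == path_number H h) =
  (#|path_tuples G h| == #|path_tuples H h|).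
Proof.
case: h => [|h]; first by rewrite !path_number0.
by rewrite !path_number_double -!muln2 eqn_pmul2r.
Qed.

Lemma leq_path_tuples (G H : sgraph) (f : G -> H) h :
    injective f -> (forall x y, adj (f x) (f y) = adj x y) ->
  #|path_tuples G h| <= #|path_tuples H h|.
Proof.
move=> f_inj f_adj.
have F_inj: injective (fun t : h.+1.-tuple G => [tuple of map f t]).
  by move=> t u /(congr1 val)/= /(inj_map f_inj) /val_inj.
rewrite -(card_imset _ F_inj); apply: subset_leq_card.
apply/subsetP=> _ /imsetP[t Pt ->]; move: Pt; rewrite !inE /=.
by rewrite (map_inj_uniq f_inj) sorted_map (eq_sorted (e' := @adj G)).
Qed.

Lemma isomorphic_sym (G H : sgraph) : isomorphic G H -> isomorphic H G.
Proof.
case=> f [g fK gK] f_adj; exists g; first by exists f.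
by move=> x y; rewrite -f_adj !gK.
Qed.

Lemma isomorphic_trans (G H K : sgraph) :
  isomorphic G H -> isomorphic H K -> isomorphic G K.
Proof.
case=> f f_bij f_adj [g g_bij g_adj]; exists (g \o f); first exact: bij_comp.
by move=> x y; rewrite /= g_adj f_adj.
Qed.

Lemma isomorphic_path_tuples (G H : sgraph) h :
  isomorphic G H -> #|path_tuples G h| = #|path_tuples H h|.
Proof.
move=> isoGH; apply/eqP; rewrite eqn_leq.
have [f /bij_inj f_inj f_adj] := isoGH.
have [g /bij_inj g_inj g_adj] := isomorphic_sym isoGH.
by rewrite (leq_path_tuples _ f_inj) ?(leq_path_tuples _ g_inj).
Qed.

Lemma path_tuples_eq0 (G : sgraph) h : #|G| <= h -> #|path_tuples G h| = 0.
Proof.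
move=> leGh; apply: eq_card0 => t; rewrite inE; apply/andP=> -[/card_uniqP Et _].
by have:= max_card (mem t); rewrite Et size_tuple ltnNge leGh.
Qed.

Lemma path_number_gt0 (G : sgraph) h :
  (0 < path_number G h) = (0 < #|path_tuples G h|).
Proof. by case: h => [|h]; rewrite ?path_number0 // path_number_double double_gt0. Qed.

Lemma path_number_eq0 (G : sgraph) h :
  longest_path G < h -> path_number G h = 0.
Proof.
move=> lt_h; apply/eqP; rewrite -leqn0 leqNgt; apply/negP=> P_h.
have hG: h < #|G|.
  by rewrite ltnNge; apply/negP=> /path_tuples_eq0 E; rewrite path_number_gt0 E in P_h.
have := @leq_bigmax_cond _ (fun i : 'I_#|G| => 0 < path_number G i)
  (fun i => nat_of_ord i) (Ordinal hG) P_h.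
by rewrite leqNgt lt_h.
Qed.

Lemma card_path_tuples0 (G : sgraph) : #|path_tuples G 0| = #|G|.
Proof.
rewrite -[#|G|]/#|{: G}| -[RHS]expn1 -card_tuple; apply: eq_card => t.
by rewrite inE; case/tupleP: t => x t; rewrite (tuple0 t).
Qed.

(** Equal sequences have equal sizes, hence equal longest paths, beyond which all counts vanish.
    Conversely the counts determine [longest_path], whose range [#|G|] is the count for length 0. *)
Lemma path_sequence_eqP (G H : sgraph) :
  path_sequence G = path_sequence H <->
  (forall h, #|path_tuples G h| = #|path_tuples H h|).
Proof.
split=> [E h | E].
  apply/eqP; rewrite -eq_path_number; apply/eqP.
  have sz K : size (path_sequence K) = (longest_path K).+1 by rewrite size_mkseq.
  have El: longest_path G = longest_path H.
    by have := congr1 size E; rewrite !sz => -[].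
  have [le_h|lt_h] := leqP h (longest_path G).
    by have := congr1 (nth 0 ^~ h) E; rewrite !nth_mkseq -?El.
  by rewrite !path_number_eq0 -?El.
have EP h : path_number G h = path_number H h.
  by apply/eqP; rewrite eq_path_number E.
have EG: #|G| = #|H| by rewrite -!card_path_tuples0.
have El: longest_path G = longest_path H.
  by rewrite /longest_path EG; apply: eq_bigl => i; rewrite EP.
by rewrite /path_sequence El; apply: eq_mkseq.
Qed.

(** * Directed paths from a given vertex *)

Lemma card_cons_tuple (T : finType) n (P : pred (seq T)) :
  #|[set t : n.+1.-tuple T | P t]| = \sum_x #|[set t : n.-tuple T | P (x :: t)]|.
Proof.
rewrite -sum1_card (eq_bigl (fun t : n.+1.-tuple T => P t)); last first.
  by move=> t; rewrite inE.
rewrite (reindex (fun p : T * n.-tuple T => [tuple of p.1 :: p.2])) /=; last first.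
  exists (fun t => (thead t, [tuple of behead t])) => [[x t]|t] _ /=.
    by congr (_, _); apply: val_inj.
  by rewrite -tuple_eta.
rewrite -(pair_big_dep xpredT (fun x (t : n.-tuple T) => P (x :: t)) (fun _ _ => 1)) /=.
apply: eq_bigr => x _; rewrite -sum1_card.
by apply: eq_bigl => t; rewrite inE.
Qed.

(** Carrying the set [A] of visited vertices makes the count of directed paths from [x] recursive;
    only the vertices after [x] have to avoid [A]. *)
Fixpoint npaths (G : sgraph) h (A : {set G}) (x : G) : nat :=
  if h is h'.+1
  then \sum_(y | adj x y && (y \notin x |: A)) npaths h' (x |: A) y else 1.

Lemma npathsS (G : sgraph) h (A : {set G}) (x : G) :
  npaths h.+1 A x =
  \sum_(y | adj x y && (y \notin x |: A)) npaths h (x |: A) y.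
Proof. by []. Qed.

Lemma npathsE (G : sgraph) h (A : {set G}) (x : G) :
  npaths h A x = #|[set t : h.-tuple G |
    [&& path (@adj G) x t, uniq t & all [predC x |: A] t]]|.
Proof.
elim: h A x => [|h IHh] A x /=.
  rewrite -[LHS](card_tuple 0 G); apply/esym/eq_card=> t.
  by rewrite inE (tuple0 t).
rewrite (card_cons_tuple _
  (fun s => [&& path (@adj G) x s, uniq s & all [predC x |: A] s])).
rewrite [RHS](bigID (fun y => adj x y && (y \notin x |: A))) /=.
rewrite [X in _ + X]big1 ?addn0 => [|y]; last first.
  rewrite negb_and negbK => E; apply: eq_card0 => t; rewrite inE /=.
  by case/orP: E => [/negPf->|->] //; rewrite !andbF.
apply: eq_bigr => y /andP[xy Ay]; rewrite IHh; apply: eq_card => t.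
rewrite [LHS]inE [RHS]inE /= xy /= Ay /=.
rewrite -!andbA; congr (_ && _); rewrite andbCA; congr (_ && _).
rewrite -[y \notin t]/(predC (mem t) y).
have -> : all [predC y |: (x |: A)] t = all (predC1 y) t && all [predC x |: A] t.
  by rewrite -all_predI; apply: eq_all => z; rewrite !inE !negb_or.
congr (_ && _); apply/allP/idP => [E|E z zt /=]; last by apply: contraNneq E => <-.
by apply/negP=> /E; rewrite /= eqxx.
Qed.

Lemma card_path_tuples (G : sgraph) h :
  #|path_tuples G h| = \sum_(x : G) npaths h set0 x.
Proof.
rewrite (card_cons_tuple _ (fun s => uniq s && sorted (@adj G) s)).
apply: eq_bigr => x _; rewrite npathsE; apply: eq_card => t.
rewrite [LHS]inE [RHS]inE /= setU0 -[x \notin t]/(predC (mem t) x).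
have -> : predC (mem t) x = all [predC [set x]] t.
  apply/idP/allP => [E z zt|E] /=; first by rewrite inE; apply: contraNneq E => <-.
  by apply/negP=> /E; rewrite /= set11.
by rewrite andbC [all _ _ && _]andbC.
Qed.

(** * Counting paths in a clique with legs *)

Section Broom.
Variables (K I : finType) (l : I -> nat).

(** [None] is the root; the vertex [j] of leg [i] has distance [j + 1] from it. *)
Definition spider_adj : rel (option {i : I & 'I_(l i)}) := fun p q =>
  match p, q with
  | None, Some (existT _ j) | Some (existT _ j), None => j == 0 :> nat
  | Some (existT i j), Some (existT i' j') =>
      (i == i') && ((j.+1 == j' :> nat) || (j'.+1 == j :> nat))
  | _, _ => false
  end.

Fact spider_sym : symmetric spider_adj.
Proof. by move=> [[i j]|] [[i' j']|] //=; rewrite eq_sym orbC. Qed.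

Fact spider_irrefl : irreflexive spider_adj.
Proof. by move=> [[i j]|] //=; rewrite eqn_leq ltnn andbF. Qed.

Definition spider := SGraph spider_sym spider_irrefl.

(** [K] holds the clique vertices other than the root, so the clique has order [#|K| + 1]. *)
Definition broom_adj : rel (K + spider) := fun x y =>
  match x, y with
  | inl c, inl c' => c != c'
  | inl _, inr p | inr p, inl _ => p == None
  | inr p, inr q => spider_adj p q
  end.

Fact broom_sym : symmetric broom_adj.
Proof. by move=> [c|p] [c'|q] //=; [rewrite eq_sym | exact: spider_sym]. Qed.

Fact broom_irrefl : irreflexive broom_adj.
Proof. by move=> [c|p] /=; rewrite ?eqxx ?spider_irrefl. Qed.

Definition broom := SGraph broom_sym broom_irrefl.

(* Leg [i] numbered from the root, which is at position 0; positions beyond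
   [l i] also give the root. *)
Definition leg_vertex (i : I) m : broom :=
  inr (if m is m'.+1 then omap (@Tagged I i (fun i => 'I_(l i))) (insub m')
       else None).
Arguments leg_vertex : simpl never.

Local Notation root := (inr None : broom).
Local Notation clique c := (inl c : broom).

Lemma leg_vertexS i (j : 'I_(l i)) :
  leg_vertex i j.+1 = inr (Some (Tagged (fun i => 'I_(l i)) j)).
Proof. by rewrite /leg_vertex valK. Qed.

Lemma eq_leg_vertex i m i' m' : m <= l i -> m' <= l i' ->
  (leg_vertex i m == leg_vertex i' m') = (m == m') && ((m == 0) || (i == i')).
Proof.
case: m m' => [|m] [|m'] // lt_m lt_m'.
- by rewrite (leg_vertexS (Ordinal lt_m')).
- by rewrite (leg_vertexS (Ordinal lt_m)).
rewrite (leg_vertexS (Ordinal lt_m)) (leg_vertexS (Ordinal lt_m')) eqSS.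
apply/eqP/andP => [[Ei Em]|[/eqP Em /eqP /= Ei]]; first by rewrite Ei Em !eqxx.
by subst i' m'; rewrite (bool_irrelevance lt_m lt_m').
Qed.

Lemma adj_leg_vertex i m y : 0 < m <= l i ->
  adj (leg_vertex i m) y =
  (y == leg_vertex i m.-1) || (m < l i) && (y == leg_vertex i m.+1).
Proof.
case: m => [//|m] lt_m; rewrite (leg_vertexS (Ordinal lt_m)) /=.
case: y => [c|[[i' j]|]]; first by rewrite /leg_vertex andbF.
  have := eq_leg_vertex (ltn_ord j) (ltnW lt_m).
  rewrite leg_vertexS => ->; rewrite /= [i == i']eq_sym.
  have [lt_Sm|] := ltnP m.+1 (l i).
    have := eq_leg_vertex (ltn_ord j) lt_Sm.
    rewrite leg_vertexS => ->; rewrite /= eqSS [m.+1 == j]eq_sym.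
    by case: (i' == i); rewrite ?andbT ?andbF // orbC.
  have [Ei|//] := eqVneq i' i; last by rewrite andbF.
  rewrite !andbT orbF /= -Ei => le_l; rewrite [m.+1 == j]eqn_leq.
  by rewrite [m < j]ltnNge -ltnS (leq_trans (ltn_ord j) le_l).
rewrite -[inr None]/(leg_vertex i 0) eq_leg_vertex ?(ltnW lt_m) //=.
rewrite andbT [0 == m]eq_sym; have [lt_Sm|_] := ltnP m.+1 (l i).
  by rewrite eq_leg_vertex //= orbF.
by rewrite orbF.
Qed.

Lemma big_broom (P : pred broom) (F : broom -> nat) :
  \sum_(y | P y) F y =
  \sum_(c | P (clique c)) F (clique c) + P root * F root +
  \sum_i \sum_(j < l i | P (leg_vertex i j.+1)) F (leg_vertex i j.+1).
Proof.
rewrite big_sumType /= -addnA; congr (_ + _).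
rewrite (bigID (pred1 None)) /=; congr (_ + _).
  rewrite (eq_bigl (fun p => (p == None) && P root)); last first.
    by move=> p; rewrite andbC; case: eqP => // ->.
  rewrite big_mkcondr big_pred1_eq; case: (P root); by rewrite ?mul1n.
rewrite sig_big_dep /=.
rewrite (reindex_omap Some id) /=; last by case=> [//|] /andP[].
apply: eq_big => [[i j]|[i j] _] /=; last by rewrite leg_vertexS.
by rewrite leg_vertexS eqxx !andbT.
Qed.

Lemma sum_adj_root (P : pred broom) (F : broom -> nat) :
  \sum_(y | adj root y && P y) F y =
  \sum_(c | P (clique c)) F (clique c) +
  \sum_i ((0 < l i) && P (leg_vertex i 1)) * F (leg_vertex i 1).
Proof.
rewrite big_broom /= mul0n addn0; congr (_ + _); apply: eq_bigr => i _.
case: (posnP (l i)) => [li0|li_gt0].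
  by rewrite big1 // => j; have := ltn_ord j; rewrite {2}li0.
rewrite (eq_bigl (fun j => (j == Ordinal li_gt0) && P (leg_vertex i 1))).
  by rewrite big_mkcondr big_pred1_eq; case: (P _); rewrite ?mul1n.
move=> j; rewrite valK /= -val_eqE /=.
by case: (val j =P 0) => //= ->.
Qed.

Lemma sum_adj_clique c (P : pred broom) (F : broom -> nat) :
  \sum_(y | adj (clique c) y && P y) F y =
  \sum_(c' | (c != c') && P (clique c')) F (clique c') + P root * F root.
Proof.
rewrite big_broom /= [X in _ + X]big1 ?addn0 // => i _.
by rewrite big1 // => j; rewrite valK.
Qed.

(** With the previous vertex visited, the path can only go on outwards: there is one path if the leg
    is long enough, and none otherwise. *)
Lemma npaths_outward h i m (A : {set broom}) :
    0 < m <= l i -> leg_vertex i m.-1 \in A ->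
    (forall m', m < m' <= l i -> leg_vertex i m' \notin A) ->
  npaths h A (leg_vertex i m) = (m + h <= l i).
Proof.
elim: h m A => [|h IHh] m A lim Ai freeA.
  by rewrite addn0; case/andP: lim => _ ->.
rewrite npathsS.
have [m_gt0 le_m] := andP lim.
have [lt_m|le_lm] := ltnP m (l i); last first.
  rewrite big1 => [|y].
    by rewrite leqNgt (leq_ltn_trans le_lm) // addnS ltnS leq_addr.
  rewrite adj_leg_vertex // ltnNge le_lm orbF => /andP[/eqP->].
  by rewrite !inE Ai orbT.
rewrite (big_pred1 (leg_vertex i m.+1)) => [|y].
  rewrite IHh ?addSnnS ?setU11 // => m' /andP[lt_m' le_m'].
  have lt_mm': m < m' by apply: ltnW.
  by rewrite !inE eq_leg_vertex // gtn_eqF //= freeA ?lt_mm'.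
rewrite adj_leg_vertex // lt_m /=; have [->|neq] := eqVneq y (leg_vertex i m.-1).
  have lt_pS: m.-1 < m.+1 by rewrite ltnS leq_pred.
  by rewrite setU1r //= eq_leg_vertex ?(leq_trans (leq_pred m)) // (ltn_eqF lt_pS).
rewrite /=; case: eqVneq => [->|//].
by rewrite !inE eq_leg_vertex // gtn_eqF //= freeA ?leqnn.
Qed.

Definition free_clique (A : {set broom}) := #|[set c : K | clique c \notin A]|.

Lemma free_clique_spider p A : free_clique (inr p |: A) = free_clique A.
Proof. by apply: eq_card => c; rewrite !inE. Qed.

Lemma free_clique0 : free_clique set0 = #|K|.
Proof. by apply: eq_card => c; rewrite !inE. Qed.

Lemma free_cliqueU1 c (A : {set broom}) :
  clique c \notin A -> free_clique (clique c |: A) = (free_clique A).-1.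
Proof.
move=> Ac; rewrite /free_clique [in RHS](cardsD1 c) inE Ac /=.
by apply: eq_card => c'; rewrite !inE negb_or.
Qed.

(** Once the root is visited the path cannot leave the clique, and it is an arrangement of [h] free
    clique vertices. *)
Lemma npaths_clique h (A : {set broom}) c :
  root \in A -> npaths h A (clique c) = free_clique (clique c |: A) ^_ h.
Proof.
elim: h A c => [|h IHh] A c rA //.
rewrite npathsS sum_adj_clique setU1r // mul0n addn0.
rewrite (eq_bigl (mem [set c' | clique c' \notin clique c |: A])) => [|c'].
  rewrite ffactnS -sum_nat_const; apply: eq_bigr => c'; rewrite /= inE => fc'.
  by rewrite IHh ?setU1r // free_cliqueU1.
by rewrite !inE; case: eqVneq => // ->; rewrite eqxx.
Qed.

(** Legs in [D] are entirely free, the others are blocked at their first vertex. For [h = 0] the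
    guard [0 < h] leaves only the falling factorial, which is 1. *)
Lemma npaths_root h (A : {set broom}) (D : pred I) :
    (forall i m, D i -> 0 < m <= l i -> leg_vertex i m \notin A) ->
    (forall i, ~~ D i -> 0 < l i -> leg_vertex i 1 \in A) ->
  npaths h A root = \sum_i (D i && (0 < h <= l i)) + free_clique A ^_ h.
Proof.
case: h => [|h] freeD usedD.
  by rewrite big1 // => i _; rewrite andbF.
rewrite npathsS sum_adj_root addnC; congr (_ + _).
  apply: eq_bigr => i _; have [li0|li_gt0] := posnP (l i).
    by rewrite li0 andbF.
  have [Di|/usedD Ai] := boolP (D i); last by rewrite setU1r ?Ai.
  have leg_neq m: 0 < m <= l i -> leg_vertex i m \notin root |: A.
    move=> lim; rewrite !inE negb_or freeD // andbT -[root]/(leg_vertex i 0).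
    by case/andP: lim => m_gt0 le_m; rewrite eq_leg_vertex // gtn_eqF.
  rewrite leg_neq // npaths_outward ?setU11 ?mul1n //.
  by move=> [|m] // /andP[_ le_m]; rewrite leg_neq.
rewrite (eq_bigl (mem [set c' | clique c' \notin A])) => [|c']; last by rewrite !inE.
rewrite ffactnS -sum_nat_const; apply: eq_bigr => c; rewrite /= inE => fc.
by rewrite npaths_clique ?setU11 // free_cliqueU1 ?inE // free_clique_spider.
Qed.

(** The guard [0 < s] gives [legs 0 = 0], so that [legs h + k ^_ h] counts the paths from the root
    for [h = 0] too. *)
Definition legs s := \sum_i (0 < s <= l i).

(** With [n] clique vertices free, the next step goes to one of them, or to the root and from there
    into a leg or back into the clique. *)
Fixpoint clique_npaths (b : nat -> nat) h n : nat :=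
  if h is h'.+1 then n * clique_npaths b h' n.-1 + (b h' + n ^_ h') else 1.

Lemma npaths_clique_root h (A : {set broom}) c :
    root \notin A -> (forall i m, 0 < m <= l i -> leg_vertex i m \notin A) ->
  npaths h A (clique c) = clique_npaths legs h (free_clique (clique c |: A)).
Proof.
elim: h A c => [|h IHh] A c rA freeA //.
rewrite npathsS sum_adj_clique; congr (_ + _).
  rewrite (eq_bigl (mem [set c' | clique c' \notin clique c |: A])) => [|c'].
    rewrite -sum_nat_const; apply: eq_bigr => c'; rewrite /= inE => fc'.
    rewrite IHh ?(free_cliqueU1 fc') // ?inE // => i m lim.
    by rewrite !inE freeA.
  by rewrite !inE; case: eqVneq => // ->; rewrite eqxx.
rewrite !inE rA mul1n (@npaths_root _ _ predT) // => i m _ lim.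
by rewrite !inE freeA.
Qed.

(** The path is forced down to the root, which it reaches with [h - m] steps left; from there leg
    [i] is blocked, but the other legs and the clique are open. *)
Lemma npaths_inward h i m (A : {set broom}) :
    m <= l i -> (m < l i -> leg_vertex i m.+1 \in A) ->
    (forall m', m' <= m -> leg_vertex i m' \notin A) ->
    (forall i' m', i' != i -> 0 < m' <= l i' -> leg_vertex i' m' \notin A) ->
  npaths h A (leg_vertex i m) =
    if h < m then 1 else
    \sum_(i' | i' != i) (0 < h - m <= l i') + free_clique A ^_ (h - m).
Proof.
elim: m h A => [|m IHm] h A le_m usedA freeA freeD.
  rewrite ltn0 subn0 -[leg_vertex i 0]/root.
  rewrite (@npaths_root _ _ [pred i' | i' != i]) => [|//|i']; last first.
    by rewrite negbK => /eqP-> /usedA.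
  congr (_ + _); rewrite [RHS]big_mkcond.
  by apply: eq_bigr => i' _ /=; case: eqP.
case: h => [//|h]; rewrite npathsS subSS ltnS.
rewrite (big_pred1 (leg_vertex i m)) => [|y].
  rewrite IHm ?(ltnW le_m) ?setU11 ?free_clique_spider //.
    move=> m' le_m'; rewrite !inE eq_leg_vertex ?(leq_trans le_m') ?(ltnW le_m) //.
    by rewrite ltn_eqF //= freeA ?(leqW le_m').
  move=> i' m' neq lim'; have /andP[m'_gt0 le_m'] := lim'.
  by rewrite !inE eq_leg_vertex // (negPf neq) (gtn_eqF m'_gt0) andbF freeD.
rewrite adj_leg_vertex //=; have [->|neq] := eqVneq y (leg_vertex i m).
  by rewrite /= !inE eq_leg_vertex ?(ltnW le_m) // ltn_eqF //= freeA.
have [lt_m|//] := ltnP m.+1 (l i).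
by case: eqVneq => //= ->; rewrite setU1r ?usedA.
Qed.

(** The two summands correspond to a first step to position [j] and to position [j + 2]. *)
Lemma npaths_leg h i j : j < l i ->
  npaths h.+1 set0 (leg_vertex i j.+1) =
  (if h < j then 1 else
    \sum_(i' | i' != i) (0 < h - j <= l i') + #|K| ^_ (h - j)) +
  (j.+1 + h < l i).
Proof.
move=> lt_j; rewrite npathsS (bigD1 (leg_vertex i j)); last first.
  rewrite adj_leg_vertex //= eqxx setU0 in_set1 /=.
  by rewrite eq_leg_vertex ?(ltnW lt_j) // ltn_eqF.
congr (_ + _).
  rewrite npaths_inward ?setU11 ?free_clique_spider ?free_clique0 // ?(ltnW lt_j) //.
    move=> m le_m; have lt_m: m < j.+1 by [].
    rewrite setU0 in_set1 eq_leg_vertex ?(ltn_eqF lt_m) //.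
    by rewrite (leq_trans le_m) // ltnW.
  move=> i' m' neq /andP[m'_gt0 le_m']; rewrite setU0 in_set1 eq_leg_vertex //.
  by rewrite (negPf neq) (gtn_eqF m'_gt0) andbF.
have [lt_Sj|le_l] := ltnP j.+1 (l i); last first.
  rewrite big1 => [|y]; last first.
    rewrite adj_leg_vertex //= ltnNge le_l orbF.
    by case: eqP => //; rewrite andbF.
  by rewrite ltnNge (leq_trans le_l) // leq_addr.
rewrite (big_pred1 (leg_vertex i j.+2)) => [|y].
  rewrite npaths_outward ?setU11 // => m /andP[lt_m le_m].
  by rewrite setU0 in_set1 eq_leg_vertex // (gtn_eqF (ltnW lt_m)).
rewrite adj_leg_vertex //= lt_Sj /= setU0 inE.
have [->|] := eqVneq y (leg_vertex i j).
  by rewrite andbF eq_leg_vertex ?(ltnW lt_j) // (ltn_eqF (leqnSn j.+1)).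
rewrite andbT => _; case: eqVneq => //= ->.
by rewrite eq_leg_vertex // gtn_eqF.
Qed.

Lemma card_broom : #|broom| = #|K| + 1 + \sum_i l i.
Proof.
rewrite -sum1_card big_broom sum1_card; congr (_ + _ + _).
by apply: eq_bigr => i _; rewrite sum1_card card_ord.
Qed.

Lemma legs0 : legs 0 = 0.
Proof. by rewrite /legs big1. Qed.

Lemma sum_ltn_recr m n (Y : nat -> nat) :
  \sum_(s < m) (s < n.+1) * Y s = \sum_(s < m) (s < n) * Y s + (n < m) * Y n.
Proof.
have [lt_nm|le_mn] := ltnP n m; last first.
  rewrite addn0; apply: eq_bigr => s _.
  by rewrite !(leq_trans (ltn_ord s)) // ltnW.
rewrite (bigD1 (Ordinal lt_nm)) //= [in RHS](bigD1 (Ordinal lt_nm)) //=.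
rewrite ltnSn ltnn addnC; congr (_ + _); apply: eq_bigr => s neq.
by rewrite ltnS leq_eqVlt; have /negPf-> : s != n :> nat by [].
Qed.

(** Replaces a sum over the positions of a leg by one over a range independent of the leg, with
    indicators that summation over the legs turns into values of [legs]. The positions beyond [h]
    number [n] minus the second sum on the left. *)
Lemma sum_if_ltn h n (Y : nat -> nat) :
  \sum_(j < n) (if h < j then 1 else Y j) + \sum_(s < h.+1) (s < n) =
  n + \sum_(s < h.+1) (s < n) * Y s.
Proof.
elim: n => [|n IHn]; first by rewrite big_ord0 !big1.
have := sum_ltn_recr h.+1 n (fun=> 1); have := sum_ltn_recr h.+1 n Y.
under [in X in _ -> X -> _]eq_bigr do rewrite muln1.
under [X in _ -> _ = X + _ -> _]eq_bigr do rewrite muln1.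
move=> -> ->; rewrite big_ord_recr /= ltnS.
rewrite addnACA IHn; case: (leqP n h) => _ /=; rewrite ?mul1n ?mul0n; lia.
Qed.

(** Reversing the order of the positions reduces this to the case [Y = 0] of [sum_if_ltn]. *)
Lemma sum_shift_ltn h n :
  \sum_(j < n) (j.+1 + h < n) + \sum_(s < h.+1) (s < n) = n.
Proof.
have := sum_if_ltn h n (fun=> 0).
rewrite [X in _ = _ + X]big1 ?addn0 => [E|s _]; last by rewrite muln0.
apply: etrans E; congr (_ + _); rewrite (reindex_inj rev_ord_inj) /=.
apply: eq_bigr => j _; have lt_jn := ltn_ord j.
by have -> : ((n - j.+1).+1 + h < n) = (h < j) by lia.
Qed.

Lemma sum_legs m : \sum_i \sum_(s < m) (s < l i) = \sum_(s < m) legs s.+1.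
Proof. by rewrite exchange_big. Qed.

(* Each directed path is counted from its starting point: in the clique, at the
   root, or on a leg [i], moving outwards or inwards.  A path moving inwards may
   not leave the root along leg [i], whence the terms with [maxn]. *)
Lemma card_path_tuples_broom h :
    #|path_tuples broom h.+1| + 2 * (\sum_(j < h) legs j.+1)
    + \sum_(j < h) legs (maxn j.+1 (h - j)) =
  #|K| * clique_npaths legs h.+1 #|K|.-1 + #|K| ^_ h.+1 + 2 * (\sum_i l i)
  + \sum_(j < h) legs j.+1 * (legs (h - j) + #|K| ^_ (h - j)).
Proof.
rewrite card_path_tuples big_broom.
rewrite (eq_bigr (fun=> clique_npaths legs h.+1 #|K|.-1)) => [|c _]; last first.
  rewrite npaths_clique_root ?inE // => [|i m _]; last by rewrite inE.
  by rewrite free_cliqueU1 ?inE ?free_clique0.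
rewrite sum_nat_const mul1n.
rewrite (@npaths_root _ _ predT) => [|i m _ _|//]; last by rewrite in_set0.
rewrite free_clique0 -/(legs h.+1).
pose Y i j := \sum_(i' | i' != i) (0 < h - j <= l i') + #|K| ^_ (h - j).
rewrite [X in _ + X + _ + _](eq_bigr (fun i =>
  \sum_(j < l i) (if h < j then 1 else Y i j) +
  \sum_(j < l i) (j.+1 + h < l i))) => [|i _].
  have E1: \sum_i \sum_(j < l i) (if h < j then 1 else Y i j) +
      \sum_(s < h.+1) legs s.+1 =
      \sum_i l i + \sum_i \sum_(s < h.+1) (s < l i) * Y i s.
    rewrite -sum_legs -!big_split; apply: eq_bigr => i _.
    exact: sum_if_ltn.
  have E2: \sum_i \sum_(j < l i) (j.+1 + h < l i) + \sum_(s < h.+1) legs s.+1 =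
      \sum_i l i.
    rewrite -sum_legs -big_split; apply: eq_bigr => i _.
    exact: sum_shift_ltn.
  have E3: \sum_i \sum_(j < h.+1) (j < l i) * Y i j +
       \sum_(j < h.+1) (0 < h - j) * legs (maxn j.+1 (h - j)) =
       \sum_(j < h.+1) legs j.+1 * (legs (h - j) + #|K| ^_ (h - j)).
    rewrite exchange_big -big_split; apply: eq_bigr => j _ /=.
    rewrite /legs [RHS]big_distrl big_distrr -big_split; apply: eq_bigr => i _ /=.
    rewrite /Y [in RHS](bigD1 i) //= geq_max.
    by case: (j < l i); case: (0 < h - j); case: (h - j <= l i) => /=; lia.
  (* The terms for [j = h] are split off: those of [E1], [E2] and [E3] cancel the contribution
     [legs h.+1] of the root. *)
  move: E1 E2 E3; rewrite big_split /=.
  rewrite !(big_ord_recr h) /= subnn legs0 ffactn0.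
  rewrite -[#|xpredT|]/#|K|.
  rewrite [X in _ -> _ -> _ + (X + _) = _ -> _](eq_bigr (fun j : 'I_h =>
    legs (maxn j.+1 (h - j)))) /= => [|j _]; last by rewrite subn_gt0 ltn_ord mul1n.
  lia.
by rewrite -big_split; apply: eq_bigr => j _; rewrite npaths_leg.
Qed.

End Broom.

(** * Recovering the clique and the legs *)

Section Determined.
Variables (k L : nat) (b b' D : nat -> nat).

(** The identity of [card_path_tuples_broom] read as a system of equations for an unknown sequence
    [b], with [D] the counts of directed paths and [L] the total length of the legs. *)
Definition broom_identity (b : nat -> nat) := forall h,
  D h.+1 + 2 * (\sum_(j < h) b j.+1) + \sum_(j < h) b (maxn j.+1 (h - j)) =
  k * clique_npaths b h.+1 k.-1 + k ^_ h.+1 + 2 * L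
  + \sum_(j < h) b j.+1 * (b (h - j) + k ^_ (h - j)).

Lemma clique_npathsS (c : nat -> nat) h n :
  clique_npaths c h.+1 n = n * clique_npaths c h n.-1 + (c h + n ^_ h).
Proof. by []. Qed.

Lemma eq_clique_npaths h n :
  (forall s, s < h -> b s = b' s) -> clique_npaths b h n = clique_npaths b' h n.
Proof.
elim: h n => [|h IHh] n Eb //=; rewrite IHh ?Eb // => s lt_s.
by rewrite Eb // ltnW.
Qed.

Lemma legs_determined s : b 0 = b' 0 -> 2 < b 1 -> 2 < b' 1 ->
  broom_identity b -> broom_identity b' -> b s = b' s.
Proof.
move=> b0 b1_gt2 b'1_gt2 Eb Eb'; elim/ltn_ind: s => -[//|s] IHs.
have EM n : clique_npaths b s.+1 n = clique_npaths b' s.+1 n.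
  exact: eq_clique_npaths.
(* This equation involves no index above [s.+1]. Unrolling [clique_npaths] once exposes [b s.+1]
   with coefficient [k]; the rest of it is known by [EM]. *)
have := Eb s.+1; have := Eb' s.+1.
rewrite (clique_npathsS b) (clique_npathsS b') EM.
set M := clique_npaths _ _ _; set Q := _ ^_ s.+1.
case: s IHs {EM} @M @Q => [|s] IHs M Q.
  rewrite !big_ord1 !subn0 maxnn ffactn1; set A := k ^_ 2.
  set x := b 1 in b1_gt2 *; set y := b' 1 in b'1_gt2 *.
  move: (D 2) M Q A x y b1_gt2 b'1_gt2; clear.
  move=> d M Q A x y x_gt2 y_gt2 Ey Ex.
  (* That is, [(x - y) (x + y + 2k - 3) = 0], where the second factor is positive because [x] and
     [y] exceed 2. *)
  have {Ex Ey} E: x * x + 2 * k * x + 3 * y = y * y + 2 * k * y + 3 * x by lia.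
  case: (ltngtP x y) => // [lt_xy|lt_yx].
    have [z yz] : exists z, y = x + z.+1 by exists (y - x).-1; lia.
    by subst y; nia.
  have [z xz] : exists z, x = y + z.+1 by exists (x - y).-1; lia.
  by subst x; nia.
(* For [h = s.+2] the unknown [b h] occurs in the sums only at [j = 0] and [j = h - 1]; the middle
   terms have smaller indices. *)
rewrite !(big_ord_recl s.+1) !(big_ord_recr s) /= !subn0.
rewrite /bump /= add1n.
have Eb1 : b 1 = b' 1 by rewrite IHs.
have -> : s.+2 - s.+1 = 1 by lia.
have -> : maxn 1 s.+2 = s.+2 by lia.
have -> : maxn s.+2 1 = s.+2 by lia.
have Elt (i : 'I_s) : i.+2 < s.+2 by rewrite !ltnS.
have -> : \sum_(i < s) b (1 + i).+1 = \sum_(i < s) b' (1 + i).+1.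
  by apply: eq_bigr => i _; rewrite IHs.
have -> : \sum_(i < s) b (maxn (1 + i).+1 (s.+2 - (1 + i))) =
    \sum_(i < s) b' (maxn (1 + i).+1 (s.+2 - (1 + i))).
  by apply: eq_bigr => i _; rewrite IHs // gtn_max Elt; lia.
have -> : \sum_(i < s) b (1 + i).+1 * (b (s.+2 - (1 + i)) + k ^_ (s.+2 - (1 + i))) =
    \sum_(i < s) b' (1 + i).+1 * (b' (s.+2 - (1 + i)) + k ^_ (s.+2 - (1 + i))).
  by apply: eq_bigr => i _; rewrite !IHs //; lia.
rewrite Eb1 ffactn1; set y := b' s.+2; set x := b s.+2.
set B := \sum_(i < s) _; set C := \sum_(i < s) _; set E := \sum_(i < s) _.
move: (k ^_ _) (k ^_ _) (D _) (b' 1) b'1_gt2 => F F' d z z_gt2.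
move: B C E M Q x y; clear - z_gt2 => B C E M Q x y Ey Ex.
(* The coefficient [2z + 2k - 4] is positive because [z > 2]. *)
have E1 : 2 * z * x + 2 * k * x + 4 * y = 2 * z * y + 2 * k * y + 4 * x by lia.
case: (ltngtP x y) => // [lt_xy|lt_yx].
  have [t yt] : exists t, y = x + t.+1 by exists (y - x).-1; lia.
  by subst y; have := leq_mul z_gt2 (leqnn t.+1); lia.
have [t xt] : exists t, x = y + t.+1 by exists (x - y).-1; lia.
by subst x; have := leq_mul z_gt2 (leqnn t.+1); lia.
Qed.

End Determined.

(** Each element is sent to the one with the same index in the enumeration of the corresponding
    fibre of [l']. *)
Lemma fibrewise_injection (I I' : finType) (l : I -> nat) (l' : I' -> nat) :
    (forall v, #|[set i | l i == v]| = #|[set i | l' i == v]|) ->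
  exists2 e : I -> I', injective e & forall i, l' (e i) = l i.
Proof.
move=> El; have [i0 _|I_0] := pickP (@predT I); last first.
  by exists (fun i => False_rect I' (Bool.diff_true_false (I_0 i))) => i; have := I_0 i.
have: 0 < #|[set i | l' i == l i0]|.
  by rewrite -El; apply/card_gt0P; exists i0; rewrite inE.
case/card_gt0P=> i0' _.
pose fib i := enum [set x | l x == l i]; pose fib' i := enum [set x | l' x == l i].
pose e i := nth i0' (fib' i) (index i (fib i)).
have lt_index i : index i (fib i) < size (fib' i).
  by rewrite -cardE -El cardE index_mem mem_enum inE.
have e_l i : l' (e i) = l i.
  by have := mem_nth i0' (lt_index i); rewrite mem_enum inE => /eqP.
exists e => // i j eq_e; have eq_l : l i = l j by rewrite -!e_l eq_e.
have Ef : fib i = fib j by rewrite /fib eq_l.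
have Ef' : fib' i = fib' j by rewrite /fib' eq_l.
have fib_mem x : l x = l i -> x \in fib i by move=> lx; rewrite mem_enum inE lx.
suff Eidx : index i (fib i) = index j (fib i).
  by rewrite -[LHS](nth_index i (fib_mem i erefl)) Eidx nth_index ?fib_mem.
apply/eqP; rewrite -(nth_uniq i0' _ _ (enum_uniq [set x | l' x == l i])) ?lt_index //.
  by apply/eqP; move: eq_e; rewrite /e -Ef -Ef'.
by rewrite -/(fib' i) Ef Ef' lt_index.
Qed.

(** Injections suffice, since the induced injection of brooms is bijective by cardinality. *)
Lemma broom_isomorphic (K I K' I' : finType) (l : I -> nat) (l' : I' -> nat)
    (g : K -> K') (e : I -> I') :
    injective g -> injective e -> (forall i, l' (e i) = l i) ->
    #|broom K l| = #|broom K' l'| ->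
  isomorphic (broom K l) (broom K' l').
Proof.
move=> g_inj e_inj El Ecard.
pose f (x : broom K l) : broom K' l' :=
  match x with
  | inl c => inl (g c)
  | inr None => inr None
  | inr (Some (existT i j)) =>
      inr (Some (Tagged (fun i => 'I_(l' i)) (cast_ord (esym (El i)) j)))
  end.
have f_inj : injective f.
  move=> [c|[[i j]|]] [c'|[[i' j']|]] //= => [[/g_inj->]//|[/e_inj Ei]].
  subst i' => Ej; congr (inr (Some (Tagged _ _))); exact: val_inj.
exists f; first by apply: inj_card_bij f_inj _; rewrite Ecard.
by move=> [c|[[i j]|]] [c'|[[i' j']|]] //=; rewrite (inj_eq g_inj, inj_eq e_inj).
Qed.

Lemma card_ge_legs (I : finType) (l : I -> nat) s :
  0 < s -> #|[set i | s <= l i]| = legs l s.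
Proof.
move=> s_gt0; rewrite -sum1_card big_mkcond /legs; apply: eq_bigr => i _.
by rewrite inE s_gt0; case: leqP.
Qed.

Lemma path_tuples_broom_isomorphic (K I K' I' : finType)
    (l : I -> nat) (l' : I' -> nat) :
    #|K| != 1 -> #|K'| != 1 -> 2 < #|I| -> 2 < #|I'| ->
    (forall i, 0 < l i) -> (forall i, 0 < l' i) ->
    (forall h, #|path_tuples (broom K l) h| = #|path_tuples (broom K' l') h|) ->
  isomorphic (broom K l) (broom K' l').
Proof.
move=> K_neq1 K'_neq1 I_gt2 I'_gt2 l_gt0 l'_gt0 E.
have E0 := E 0; rewrite !card_path_tuples0 in E0.
(* The number of directed edges minus twice [#|K| + \sum_i l i] is [k (k - 1)], which confuses only
   the values 0 and 1 of [k]. *)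
have [EK EL] : #|K| = #|K'| /\ \sum_i l i = \sum_i l' i.
  have := card_path_tuples_broom K l 0; have := card_path_tuples_broom K' l' 0.
  rewrite E !big_ord0 /= !legs0 !ffactn0 !ffactn1.
  rewrite !card_broom in E0; move: K_neq1 K'_neq1 E0.
  move: (\sum_i l i) (\sum_i l' i) #|K| #|K'| #|path_tuples (broom K' l') 1|.
  move=> L L' k k' d k_neq1 k'_neq1 E0 E1 E2.
  have Ek : k * k.-1 = k' * k'.-1 by lia.
  suff : k = k' by lia.
  by move: Ek k_neq1 k'_neq1; clear; case: k k' => [|[|k]] [|[|k']] //=; nia.
have legs1 (J : finType) (m : J -> nat) : (forall i, 0 < m i) -> legs m 1 = #|J|.
  move=> m_gt0; rewrite -card_ge_legs // -cardsT.
  by apply: eq_card => i; rewrite !inE m_gt0.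
have Elegs s : legs l s = legs l' s.
  apply: (@legs_determined #|K| (\sum_i l i) _ _
            (fun h => #|path_tuples (broom K l) h|)).
  - by rewrite !legs0.
  - by rewrite legs1.
  - by rewrite legs1.
  - exact: card_path_tuples_broom.
  - by move=> h; rewrite E EK EL; apply: card_path_tuples_broom.
have card_ge s : #|[set i | s <= l i]| = #|[set i | s <= l' i]|.
  (* Since [legs 0 = 0], the case [s = 0] needs the total number of legs, which is [legs 1]. *)
  case: s => [|s]; last by rewrite !card_ge_legs.
  have := Elegs 1; rewrite !legs1 // -!cardsT => EI.
  by rewrite -[LHS]/#|[set: I]| EI; apply: eq_card.
have split_ge (J : finType) (m : J -> nat) v :
    #|[set i | v <= m i]| = #|[set i | m i == v]| + #|[set i | v < m i]|.
  rewrite -(cardsID [set i | v < m i]) addnC; congr (_ + _); apply: eq_card => i.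
    by rewrite !inE -leqNgt eqn_leq.
  by rewrite !inE andbC; case: ltngtP.
have [e e_inj El] : exists2 e : I -> I', injective e & forall i, l' (e i) = l i.
  apply: fibrewise_injection => v; apply/eqP.
  by rewrite -(eqn_add2r #|[set i | v < l i]|) -split_ge !card_ge split_ge.
pose g x := enum_val (cast_ord EK (enum_rank x)).
apply: (@broom_isomorphic _ _ _ _ _ _ g e) => //.
by move=> x y /enum_val_inj/cast_ord_inj/enum_rank_inj.
Qed.

(** The single clique vertex becomes the leg indexed by [None]. *)
Lemma broom_clique1 (K I : finType) (l : I -> nat) : #|K| = 1 ->
  isomorphic (broom K l)
    (broom void (fun i : option I => if i is Some i' then l i' else 1)).
Proof.
move=> /eqP/fintype1P[c0 Kc0].
set l' := fun i : option I => _.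
pose f (x : broom K l) : broom void l' :=
  match x with
  | inl c => inr (Some (Tagged (fun i => 'I_(l' i)) (i := None) ord0))
  | inr None => inr None
  | inr (Some (existT i j)) =>
      inr (Some (Tagged (fun i => 'I_(l' i)) (i := Some i) j))
  end.
pose f' (y : broom void l') : broom K l :=
  match y with
  | inl c => match c with end
  | inr None => inr None
  | inr (Some (existT None j)) => inl c0
  | inr (Some (existT (Some i) j)) => inr (Some (Tagged (fun i => 'I_(l i)) j))
  end.
exists f.
  exists f' => [[c|[[i j]|]]|[[]|[[[i|] j]|]]] //=; first by rewrite (Kc0 c).
  by rewrite (ord1 j).
move=> [c|[[i j]|]] [c'|[[i' j']|]] //=; first by rewrite (Kc0 c) (Kc0 c') eqxx.
Qed.

(** * Legs of a starlike tree *)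

Lemma maximal_path (G : sgraph) (x : G) p :
    path (@adj G) x p -> uniq (x :: p) ->
  exists q, [/\ path (@adj G) x (p ++ q), uniq (x :: p ++ q) &
    forall y, adj (last x (p ++ q)) y -> y \in x :: p ++ q].
Proof.
have [n] := ubnP (#|G| - size p); elim: n p => // n IHn p lt_n Pp Up.
have [y /andP[py yp]|max_p] := pickP [pred y | adj (last x p) y & y \notin x :: p].
  have Up' : uniq (x :: rcons p y) by rewrite -rcons_cons rcons_uniq yp.
  have [||q] := IHn (rcons p y) _ _ Up'; last by rewrite cat_rcons; exists (y :: q).
    have /card_uniqP E := Up'; have := max_card (mem (x :: rcons p y)).
    by rewrite E /= size_rcons; move: #|G| lt_n => N; lia.
  by rewrite rcons_path Pp.
exists [::]; rewrite cats0; split=> // y py.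
by have /negbT := max_p y; rewrite /= py negbK.
Qed.

(** A chord would close the segment from [i] to [j], which has at least three vertices, to a
    cycle. *)
Lemma acyclic_chordless (G : sgraph) (x0 : G) s i j :
    acyclic G -> sorted (@adj G) s -> uniq s -> i < j < size s ->
  adj (nth x0 s i) (nth x0 s j) = (j == i.+1).
Proof.
move=> acG Ss Us /andP[lt_ij lt_js].
have [->|neq] := eqVneq j i.+1.
  by have := sortedP x0 Ss i; apply; lia.
apply/negP=> chord; pose c := take (j - i).+1 (drop i s).
have size_c : size c = (j - i).+1 by rewrite size_takel // size_drop; lia.
have nth_c k : k <= j - i -> nth x0 c k = nth x0 s (i + k).
  by move=> le_k; rewrite nth_take ?ltnS // nth_drop.
apply: (acG c); first by rewrite size_c; lia.
have Uc : uniq c by rewrite take_uniq ?drop_uniq.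
have : sorted (@adj G) c by rewrite take_sorted ?drop_sorted.
rewrite /ucycle Uc andbT.
have := nth_c 0 isT; have := nth_c (j - i) (leqnn _); have := nth_last x0 c.
rewrite addn0 subnKC ?(ltnW lt_ij) // size_c /=.
case: (c) size_c => //= a c' _ -> Ej Ei.
by rewrite rcons_path => ->; rewrite Ej Ei adj_sym.
Qed.

Section Starlike.
Variables (S : sgraph) (v0 : S).
Hypothesis starS : starlike_tree S v0.

Let acS : acyclic S. Proof. by case: starS => -[]. Qed.

(** A path from [v0] through [x] that cannot be prolonged; [s] leaves out [v0]. *)
Definition is_leg (x : S) (s : seq S) :=
  [/\ ohead s = Some x, sorted (@adj S) (v0 :: s), uniq (v0 :: s) &
      forall y, adj (last v0 s) y -> y \in v0 :: s].

Lemma leg_exists x : adj v0 x -> exists s, is_leg x s.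
Proof.
move=> v0x; have [||q [Pq Uq max_q]] := @maximal_path S v0 [:: x].
- by rewrite /= v0x.
- by rewrite /= inE andbT; apply: contraTneq v0x => ->; rewrite adj_irrefl.
by exists (x :: q).
Qed.

Lemma adj_leg x s i j : is_leg x s -> i <= size s -> j <= size s ->
  adj (nth v0 (v0 :: s) i) (nth v0 (v0 :: s) j) = (j == i.+1) || (i == j.+1).
Proof.
case=> _ Ss Us _ le_i le_j; case: (ltngtP i j) => [lt_ij|lt_ji|->].
- by rewrite acyclic_chordless ?lt_ij // orbC; case: (i =P j.+1) => //; lia.
- by rewrite adj_sym acyclic_chordless ?lt_ji //; case: (j =P i.+1) => //; lia.
by rewrite adj_irrefl; lia.
Qed.

(** At the end of the leg this is maximality; elsewhere a neighbour off the leg would be a third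
    one, making [z] the root. *)
Lemma leg_closed x s z y :
  is_leg x s -> z \in s -> adj z y -> y \in v0 :: s.
Proof.
move=> leg_s zs zy; have [_ Ss Us max_s] := leg_s.
have [j lt_j Ez] : exists2 j, j < size s & z = nth v0 s j.
  by exists (index z s); rewrite ?index_mem ?nth_index.
have [Ej|neq_j] := eqVneq j.+1 (size s).
  by apply: max_s; rewrite -nth_last -Ej -Ez.
have lt_Sj : j.+1 < size s by lia.
apply: contraTT zs => ys; suff -> : z = v0 by case/andP: Us.
have [_ _ deg_S] := starS; apply: deg_S.
pose P k := nth v0 (v0 :: s) k.
have Ezj : z = P j.+1 by [].
have PP i k : i <= size s -> k <= size s -> (P i == P k) = (i == k).
  by move=> le_i le_k; rewrite nth_uniq.
apply: leq_trans (_ : #|[set P j; P j.+2; y]| <= _).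
  have yP k : k <= size s -> (y == P k) = false.
    by move=> le_k; apply: contraNF ys => /eqP->; rewrite mem_nth.
  rewrite setUC cardsU1 !inE !yP ?cards2 ?PP //; try lia.
rewrite subset_leq_card //; apply/subsetP => w; rewrite !inE.
by case/orP=> [/orP[]|] /eqP-> //; rewrite Ezj (adj_leg leg_s) ?eqxx ?orbT //; lia.
Qed.

(** By [leg_closed], the predecessors of a common vertex also lie on [s']. This leads back to [x], a
    neighbour of [v0] on [s'], which is the first vertex of [s'] because there are no chords. *)
Lemma leg_inj x s x' s' z :
  is_leg x s -> is_leg x' s' -> z \in s -> z \in s' -> x = x'.
Proof.
move=> leg_s leg_s' zs; have [hd_s Ss Us _] := leg_s; have [hd_s' Ss' Us' _] := leg_s'.
have v0s : v0 \notin s by case/andP: Us.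
have [j lt_j ->] : exists2 j, j < size s & z = nth v0 s j.
  by exists (index z s); rewrite ?index_mem ?nth_index.
elim: j lt_j => [|j IHj] lt_j.
  case: s hd_s {leg_s zs v0s Us} Ss lt_j => //= a s [->] /andP[v0x _] _ xs'.
  have lt_k : (index x s').+1 <= size s' by rewrite index_mem.
  have := adj_leg leg_s' (leq0n _) lt_k; rewrite /= nth_index // v0x orbF.
  move/esym/eqP=> [Ek]; case: s' hd_s' xs' Ek {Ss' Us' leg_s' lt_k} => //= b s' [->].
  by rewrite eq_sym; case: eqP.
move=> js'; apply: IHj (ltnW lt_j) _.
have := leg_closed leg_s' js' (_ : adj _ (nth v0 s j)).
have := adj_leg leg_s lt_j (ltnW lt_j); rewrite /= => ->; rewrite eqxx orbT.
move=> /(_ isT); rewrite inE => /orP[/eqP Ev|//].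
by rewrite -Ev mem_nth ?(ltnW lt_j) in v0s.
Qed.

(** The legs are indexed by the neighbours of [v0]. They are disjoint by [leg_inj], and no edge
    joins two of them by [leg_closed]. *)
Lemma starlike_spider :
  exists (I : finType) (l : I -> nat) (f : spider l -> S),
    [/\ #|I| = degree v0, forall i, 0 < l i, bijective f, f None = v0 &
        forall x y, adj (f x) (f y) = adj x y].
Proof.
pose I : finType := {x : S | adj v0 x}.
have [leg legP] : exists leg : I -> seq S, forall i, is_leg (val i) (leg i).
  apply: (@fin_all_exists I (fun=> seq S) (fun i s => is_leg (val i) s)) => i.
  exact: leg_exists (valP i).
pose l i := size (leg i).
pose f (p : spider l) : S :=
  if p is Some (existT i j) then nth v0 (leg i) j else v0.
have v0leg i : v0 \notin leg i by case: (legP i) => _ _ /andP[].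
have f_leg i (j : 'I_(l i)) : nth v0 (leg i) j \in leg i by rewrite mem_nth.
have f_inj : injective f.
  move=> [[i j]|] [[i' j']|] //= E.
  - have Ei : i = i'.
      by apply: val_inj; apply: leg_inj (legP i) (legP i') (f_leg i j) _; rewrite E.
    subst i'; congr (Some (Tagged _ _)); apply/val_inj/eqP => /=.
    rewrite -(nth_uniq v0 (ltn_ord j) (ltn_ord j')) ?E //.
    by case: (legP i) => _ _ /andP[].
  - by have := f_leg i j; rewrite E (negPf (v0leg i)).
  - by have := f_leg i' j'; rewrite -E (negPf (v0leg i')).
have head_leg (i : I) : val i \in leg i.
  by have [] := legP i; case: (leg i) => //= a s [->] _ _ _; rewrite mem_head.
(* Along a path from [v0] to [v], a step from [v0] enters a leg, and a step from a leg stays on it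
   or returns to [v0]. *)
have cover v : v = v0 \/ exists i, v \in leg i.
  have [[[_ conn] _] _ _] := starS.
  have /connectP[p] := conn v0 v; elim/last_ind: p v => [|p w IHp] v /=.
    by move=> _ ->; left.
  rewrite rcons_path last_rcons => /andP[Pp pw] ->.
  have [E|[i pi]] := IHp _ Pp erefl.
    right; rewrite E in pw; exists (Sub w pw : I).
    exact: head_leg (Sub w pw : I).
  have := leg_closed (legP i) pi pw; rewrite inE => /orP[/eqP|]; first by left.
  by right; exists i.
have f_surj v : exists p, f p = v.
  have [->|[i vi]] := cover v; first by exists None.
  have lt_v : index v (leg i) < l i by rewrite index_mem.
  exists (Some (Tagged (fun i => 'I_(l i)) (Ordinal lt_v))).
  by rewrite /= nth_index.
have [g gK] := fin_all_exists f_surj.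
exists I, l, f; split=> //.
- by rewrite card_sig /degree cardsE.
- by move=> i; rewrite /l; case: (leg i) (head_leg i).
- by exists g => // p; apply: f_inj; rewrite gK.
have root_adj i (j : 'I_(l i)) : adj v0 (nth v0 (leg i) j) = (j == 0 :> nat).
  by have := adj_leg (legP i) (leq0n _) (ltn_ord j); rewrite /= eqSS orbF.
move=> [[i j]|] [[i' j']|] /=; last by rewrite adj_irrefl.
- have [Ei|neq] := eqVneq i i'.
    subst i'; have := adj_leg (legP i) (ltn_ord j) (ltn_ord j').
    by rewrite /= !eqSS => ->; rewrite [_ == j.+1]eq_sym [j == _ :> nat]eq_sym.
  apply/negP=> /(leg_closed (legP i) (f_leg i j)); rewrite inE.
  case/orP=> [/eqP E|ji].
    by have := f_leg i' j'; rewrite E (negPf (v0leg i')).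
  case/eqP: neq; apply: val_inj.
  exact: leg_inj (legP i) (legP i') ji (f_leg i' j').
- by rewrite adj_sym root_adj.
- exact: root_adj.
Qed.

End Starlike.

(** * Generalized starlike trees as brooms *)

Lemma gen_starlike_broom (n1 : nat) (u0 : complete_graph n1) (S : sgraph) (v0 : S) :
    starlike_tree S v0 ->
  exists (K I : finType) (l : I -> nat),
    [/\ #|K| != 1, 2 < #|I|, forall i, 0 < l i &
        isomorphic (gen_starlike n1 u0 S v0) (broom K l)].
Proof.
move=> starS; have [_ deg_v0 _] := starS.
have [I [l [f [cardI l_gt0 [g fK gK] f0 f_adj]]]] := starlike_spider starS.
pose K : finType := {x : complete_graph n1 | x != u0}.
have iso : isomorphic (gen_starlike n1 u0 S v0) (broom K l).
  apply: isomorphic_sym.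
  exists (fun x : broom K l => match x with inl c => inl c | inr p => inr (f p) end
          : gen_starlike n1 u0 S v0).
    exists (fun x : gen_starlike n1 u0 S v0 =>
      match x with inl c => inl c | inr p => inr (g p) end : broom K l).
      by case=> [c|p] //=; rewrite fK.
    by case=> [c|p] //=; rewrite gK.
  have f_eq0 p : (f p == v0) = (p == None) by rewrite -f0 (can_eq fK).
  move=> [c|p] [c'|q] //=.
  - by rewrite f_eq0; case: c => c /= c_u0; rewrite /complete_adj c_u0.
  - rewrite f_eq0; case: c' => c /= c_u0.
    by rewrite /complete_adj [u0 == c]eq_sym c_u0 andbT.
(* A clique of order 2 is turned into a leg, which makes the parameters recoverable from the
   counts. *)
have [K1|K_neq1] := eqVneq #|K| 1; last by exists K, I, l; rewrite cardI.
exists void, (option I), (fun i => if i is Some i' then l i' else 1).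
split; rewrite ?card_void ?card_option ?cardI //; first by apply: ltnW.
- by case.
by apply: isomorphic_trans iso _; apply: broom_clique1.
Qed.

Theorem theorem14 (n1 n2 n1' n2' : nat)
    (u0 : complete_graph n1) (S : sgraph) (v0 : S)
    (u0' : complete_graph n1') (S' : sgraph) (v0' : S')
    (hS : starlike_tree S v0) (hn2 : #|S| = n2)
    (hS' : starlike_tree S' v0') (hn2' : #|S'| = n2') :
  isomorphic (gen_starlike n1 u0 S v0) (gen_starlike n1' u0' S' v0') <->
  path_sequence (gen_starlike n1 u0 S v0) =
  path_sequence (gen_starlike n1' u0' S' v0').
Proof.
rewrite path_sequence_eqP; split=> [iso h | Epath].
  exact: isomorphic_path_tuples.
have [K [I [l [K_neq1 I_gt2 l_gt0 iso]]]] := gen_starlike_broom u0 hS.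
have [K' [I' [l' [K'_neq1 I'_gt2 l'_gt0 iso']]]] := gen_starlike_broom u0' hS'.
apply: (isomorphic_trans iso (isomorphic_trans _ (isomorphic_sym iso'))).
apply: path_tuples_broom_isomorphic => // h.
by rewrite -(isomorphic_path_tuples h iso) -(isomorphic_path_tuples h iso').
Qed.
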